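(* Let $K$ be a finite field, $R$ a finite dimensional $K$-algebra, $l\ge1$, and $D$ a countable dimensional amenable skew field over $K$. Let $\rho:R\to\mathrm{Mat}_{l\times l}(D)$ be a (possibly infinite dimensional) representation, i.e. a unital $K$-algebra homomorphism. Then the associated element $\mathrm{rk}_\rho\in\mathrm{Rank}(R)$ is amenable: there exists a hyperfinite sequence $\{M_n\}_{n=1}^\infty$ of nonzero finitely generated left $R$-modules such that $\lim_{n\to\infty}\mathrm{rk}_{M_n}(A)=\mathrm{rk}_\rho(A)$ for every finite rectangular matrix $A$ over $R$.
   Context: A countable dimensional $K$-algebra $\mathcal A$ is (left) amenable if there exists a sequence $\{W_n\}_{n=1}^\infty$ of nonzero finite dimensional $K$-linear subspaces of $\mathcal A$ such that $\lim_{n\to\infty}\dim_K(W_n+aW_n)/\dim_K(W_n)=1$ for every $a\in\mathcal A$. A skew field over $K$ is a division ring that is a $K$-algebra. For a nonzero finitely generated left $R$-module $M$ and $A\in\mathrm{Mat}_{k\times m}(R)$, $\mathrm{rk}_M(A)$ is the $K$-rank of the linear map $M^m\to M^k$ given by $A$, divided by $\dim_K(M)$. For $\rho:R\to\mathrm{Mat}_{l\times l}(D)$ and $A\in\mathrm{Mat}_{k\times m}(R)$, let $\tilde\rho(A)$ be the $kl\times ml$ matrix over $D$ obtained by applying $\rho$ entrywise; $\mathrm{rk}_\rho(A)$ is the rank of $\tilde\rho(A)$ over $D$ divided by $l$. $\mathrm{Rank}(R)$ (the rank spectrum) is the set of all rank functions on matrices over $R$ induced in this way by unital homomorphisms of $R$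 into von Neumann regular $K$-algebras equipped with a faithful Sylvester rank function, such as $\mathrm{Mat}_{l\times l}(D)$ with its normalized rank. A family $\{M_n\}$ of finitely generated $R$-modules is hyperfinite if for any $\epsilon>0$ there is a finite family $N_1,\dots,N_t$ of finitely generated $R$-modules such that for every $n$ there exist a submodule $P_n\subset M_n$ with $\dim_K(P_n)\ge(1-\epsilon)\dim_K(M_n)$ and non-negative integers $\alpha_1,\dots,\alpha_t$ with $P_n\cong\bigoplus_{i=1}^tN_i^{\alpha_i}$. *)

(* Defs.v *)
From HB Require Import structures.
From mathcomp Require Import all_boot all_order all_algebra all_field.
From mathcomp Require Import all_classical all_reals all_analysis.
Set Implicit Arguments.
Unset Strict Implicit.
Unset Printing Implicit Defensive.
Import Order.TTheory GRing.Theory Num.Theory.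
Import numFieldNormedType.Exports.
Local Open Scope classical_set_scope.
Local Open Scope ring_scope.

(* The library's [vectType], [\dim] and [\rank] need finite dimension and, for
   the latter two, a commutative field.  The notions below apply to an arbitrary
   module, and in particular to (left) vector spaces over a skew field. *)
Section Dimension.
Variables (F : nzRingType) (V : lmodType F).
Implicit Types (B W : set V).

Definition lspan B : set V :=
  [set x | exists (n : nat) (e : 'I_n -> V) (c : 'I_n -> F),
             (forall i, B (e i)) /\ x = \sum_(i < n) c i *: e i].

Definition lfree B : Prop :=
  forall (n : nat) (e : 'I_n -> V) (c : 'I_n -> F),
    injective e -> (forall i, B (e i)) ->
    \sum_(i < n) c i *: e i = 0 -> forall i, c i = 0.

Definition lbasis W B : Prop := lfree B /\ lspan B = W.

(* Since [lspan B] is always a submodule, this forces [W] to be one. *)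
Definition has_ldim W (n : nat) : Prop :=
  exists B, lbasis W B /\ (B #= `I_n)%card.

Definition finite_ldim W : Prop := exists n, has_ldim W n.

(* Over a skew field the [n] such that [has_ldim W n] is unique when it exists;
   [ldim W] is 0, and meaningless, if [W] is not of finite dimension. *)
Definition ldim W : nat := xget 0%N [set n | has_ldim W n].

(* "Countable" includes "finite". *)
Definition countable_ldim W : Prop := exists B, lbasis W B /\ countable B.

Definition fingen : Prop := exists B, finite_set B /\ lspan B = setT.

End Dimension.
Arguments fingen {F} V.

(* The K-vector space underlying a module over a K-algebra. *)
Definition restr (K : fieldType) (R : algType K) (M : lmodType R) : Type := M.

Section Restr.
Variables (K : fieldType) (R : algType K) (M : lmodType R).

HB.instance Definition _ := GRing.Zmodule.on (restr M).

Definition restr_scale (a : K) (x : restr M) : restr M := (a%:A : R) *: (x : M).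

Fact restr_scaleA a b x :
  restr_scale a (restr_scale b x) = restr_scale (a * b) x.
Proof. by rewrite /restr_scale scalerA -scalerAl mul1r scalerA. Qed.
Fact restr_scale1 : left_id 1 restr_scale.
Proof. by move=> x; rewrite /restr_scale !scale1r. Qed.
Fact restr_scaleDr : right_distributive restr_scale +%R.
Proof. by move=> a x y; rewrite /restr_scale scalerDr. Qed.
Fact restr_scaleDl x : {morph restr_scale^~ x : a b / a + b}.
Proof. by move=> a b; rewrite /restr_scale !scalerDl. Qed.

HB.instance Definition _ := GRing.Zmodule_isLmodule.Build K (restr M)
  restr_scaleA restr_scale1 restr_scaleDr restr_scaleDl.

End Restr.

Definition kdim (K : fieldType) (R : algType K) (M : lmodType R)
  (W : set M) : nat := ldim (W : set (restr M)).

(* For a finite index type the direct sum is the full dependent product, which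
   has no module structure in the library. *)
Definition dsum (R : nzRingType) (I : finType) (N : I -> lmodType R) : Type :=
  {dffun forall i : I, N i}.

Section DirectSum.
Variables (R : nzRingType) (I : finType) (N : I -> lmodType R).
Local Notation V := (dsum N).
HB.instance Definition _ := Choice.copy V {dffun forall i : I, N i}.

Definition dsum_at (x : V) (i : I) : N i := (x : {dffun forall i : I, N i}) i.
Definition dsum_of (g : forall i, N i) : V := finfun g.

Fact dsum_ofE g i : dsum_at (dsum_of g) i = g i.
Proof. exact: ffunE. Qed.
Fact dsumP (x y : V) : (forall i, dsum_at x i = dsum_at y i) -> x = y.
Proof. by move=> exy; apply/ffunP. Qed.

Definition dsum_zero : V := dsum_of (fun i => 0).
Definition dsum_opp (x : V) : V := dsum_of (fun i => - dsum_at x i).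
Definition dsum_add (x y : V) : V :=
  dsum_of (fun i => dsum_at x i + dsum_at y i).
Definition dsum_scale (a : R) (x : V) : V :=
  dsum_of (fun i => a *: dsum_at x i).

Fact dsum_addA : associative dsum_add.
Proof. by move=> x y z; apply/dsumP=> i; rewrite !dsum_ofE addrA. Qed.
Fact dsum_addC : commutative dsum_add.
Proof. by move=> x y; apply/dsumP=> i; rewrite !dsum_ofE addrC. Qed.
Fact dsum_add0 : left_id dsum_zero dsum_add.
Proof. by move=> x; apply/dsumP=> i; rewrite !dsum_ofE add0r. Qed.
Fact dsum_addN : left_inverse dsum_zero dsum_opp dsum_add.
Proof. by move=> x; apply/dsumP=> i; rewrite !dsum_ofE addNr. Qed.

HB.instance Definition _ :=
  GRing.isZmodule.Build V dsum_addA dsum_addC dsum_add0 dsum_addN.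

Fact dsum_scaleA a b x : dsum_scale a (dsum_scale b x) = dsum_scale (a * b) x.
Proof. by apply/dsumP=> i; rewrite !dsum_ofE scalerA. Qed.
Fact dsum_scale1 : left_id 1 dsum_scale.
Proof. by move=> x; apply/dsumP=> i; rewrite !dsum_ofE scale1r. Qed.
Fact dsum_scaleDr : right_distributive dsum_scale +%R.
Proof. by move=> a x y; apply/dsumP=> i; rewrite !dsum_ofE scalerDr. Qed.
Fact dsum_scaleDl x : {morph dsum_scale^~ x : a b / a + b}.
Proof. by move=> a b; apply/dsumP=> i; rewrite !dsum_ofE scalerDl. Qed.

HB.instance Definition _ := GRing.Zmodule_isLmodule.Build R V
  dsum_scaleA dsum_scale1 dsum_scaleDr dsum_scaleDl.

End DirectSum.

Definition skew_field (D : unitRingType) : Prop :=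
  forall x : D, x != 0 -> x \is a GRing.unit.

(* Multiplication by [a] is on the left: this is left amenability. *)
Definition amenable_algebra (Rr : realType) (K : fieldType) (A : algType K)
  : Prop :=
  countable_ldim [set: A] /\
  exists W : nat -> set A,
    (forall n, finite_ldim (W n) /\ (exists2 w, W n w & w != 0)) /\
    (forall a : A,
       (fun n => (ldim [set x + a * y | x in W n & y in W n])%:R
                 / (ldim (W n))%:R : Rr) @ \oo --> (1 : Rr)).

Section Ranks.
Variables (Rr : realType) (K : fieldType) (R : algType K).

(* [A] maps [M^m] to [M^k]; this is K-linear but in general not R-linear. *)
Definition mx_act (M : lmodType R) (k m : nat) (A : 'M[R]_(k, m))
  (x : {ffun 'I_m -> M}) : {ffun 'I_k -> M} :=
  [ffun i => \sum_(j < m) A i j *: x j].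

Definition rk_mod (M : lmodType R) (k m : nat) (A : 'M[R]_(k, m)) : Rr :=
  (kdim (range (@mx_act M k m A)))%:R / (kdim [set: M])%:R.

(* Over a skew field the rank is the dimension of the left row space, which is
   also the dimension of the right column space.  The library's scaling of
   matrices is on the left, so that row vectors form a left vector space. *)
Definition mxrank_skew (D : nzRingType) (k m : nat) (A : 'M[D]_(k, m)) : nat :=
  ldim (range (fun u : 'rV[D]_k => u *m A)).

Definition rho_mx (D : nzRingType) (l : nat) (rho : R -> 'M[D]_l) (k m : nat)
  (A : 'M[R]_(k, m)) : 'M[D]_(\sum_(i < k) l, \sum_(j < m) l) :=
  \mxblock_(i < k, j < m) rho (A i j).

Definition rk_rep (D : nzRingType) (l : nat) (rho : R -> 'M[D]_l) (k m : nat)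
  (A : 'M[R]_(k, m)) : Rr := (mxrank_skew (rho_mx rho A))%:R / l%:R.

(* [f] is an isomorphism of the direct sum of the powers [N i ^ alpha i] onto
   the submodule [P]. *)
Definition hyperfinite (I : Type) (M : I -> lmodType R) : Prop :=
  forall eps : Rr, 0 < eps ->
  exists (t : nat) (N : 'I_t -> lmodType R),
    (forall i, fingen (N i)) /\
    forall n : I, exists (P : {pred M n}) (alpha : 'I_t -> nat),
      [/\ submod_closed P,
          (1 - eps) * (kdim [set: M n])%:R <= (kdim [set` P])%:R :> Rr
        & exists f : {linear dsum (fun i => {ffun 'I_(alpha i) -> N i}) -> M n},
            injective f /\ range f = [set` P]].

Definition amenable_rank (rk : forall k m : nat, 'M[R]_(k, m) -> Rr) : Prop :=
  exists M : nat -> lmodType R,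
    [/\ forall n, fingen (M n) /\ (exists x : M n, x != 0),
        hyperfinite M
      & forall (k m : nat) (A : 'M[R]_(k, m)),
          (fun n => rk_mod (M n) A) @ \oo --> rk k m A].

End Ranks.

(* Main.v *)
(* Since K is finite, a finite dimensional K-space W has |K|^(dim W) elements, so
   every dimension inequality needed follows from a (not necessarily linear)
   injection between finite sets.

   Let W_n be a Foelner sequence of D and M_n the R-submodule of D^l generated by
   W_n^l, so that dim M_n ~ l dim W_n.  A full-rank factorisation over D of the
   matrix rho(A), whose entries almost preserve W_n, gives the convergence of ranks.

   For hyperfiniteness take V = W_m almost invariant, and let V' be V enlarged by
   the entries of rho(R).  For n large, choose a maximal independent family of
   right translates V' d_1, ..., V' d_k inside W_n.  By maximality any other z with
   V' z inside W_n satisfies u z = sum u_i d_i for some u <> 0 and u_i in V', so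
   counting gives (k + 1) dim V' >= (1 - o(1)) dim W_n.  Right multiplication is
   R-linear, hence the translates by d_1, ..., d_k of the R-module generated by V^l
   form a direct sum that almost fills M_n.  If D is finite, W_n = D will do. *)
Require Import Defs.
From HB Require Import structures.
From mathcomp Require Import all_boot all_order all_algebra all_field.
From mathcomp Require Import all_classical all_reals all_analysis.
From mathcomp Require Import ring lra.
Import Order.TTheory GRing.Theory Num.Theory.
Import numFieldNormedType.Exports.
Local Open Scope classical_set_scope.
Local Open Scope ring_scope.
Set Implicit Arguments.
Unset Strict Implicit.
Unset Printing Implicit Defensive.

(** * Finite bases and subspaces over a nonzero ring *)

Section Bases.
Variables (F : nzRingType) (V : lmodType F).
Implicit Types W : set V.

Definition is_subspace W := W 0 /\ forall a x y, W x -> W y -> W (a *: x + y).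

Lemma sum_reindex m n (g : 'I_m -> 'I_n) (c : 'I_m -> F) (e : 'I_n -> V) :
  \sum_(i < m) c i *: e (g i)
  = \sum_(j < n) (\sum_(i < m | g i == j) c i) *: e j.
Proof.
rewrite (partition_big g predT) //=; apply: eq_bigr => j _.
by rewrite scaler_suml; apply: eq_bigr => i /eqP ->.
Qed.

Lemma card_enum (B : set V) n : (B #= `I_n)%card ->
  exists2 e : 'I_n -> V, injective e & forall x, B x <-> exists i, x = e i.
Proof.
rewrite (card_eqr card_II) => /card_esym/card_eqVP[f]; pose g := f \o to_setT.
exists (fun i => val (g i)) => [i j /val_inj gij|x]; last split.
- by have := congr1 (g^-1)%FUN gij; rewrite !invK ?inE.
- by move=> /mem_set Bx; exists ((g^-1)%FUN (SigSub Bx)); rewrite ?[g _]invK ?inE.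
- by move=> [i ->]; exact: set_valP.
Qed.

(** Trades the basis as a set for an indexed family, the form in which bases are handled below. *)
Lemma has_ldimP W n : has_ldim W n <-> exists e : 'I_n -> V,
  (forall c : 'I_n -> F, \sum_(i < n) c i *: e i = 0 -> forall i, c i = 0)
  /\ (forall x, W x <-> exists c : 'I_n -> F, x = \sum_(i < n) c i *: e i).
Proof.
split=> [[B [[freeB <-] /card_enum[e inj_e Be]]]|[e [free_e We]]]; last first.
  have inj_e : injective e.
    move=> i j eij; apply: contrapT => nij.
    (* If [e i = e j] with i <> j, the coefficients 1 at i and -1 at j give a relation that
       contradicts freeness, as 1 <> 0. *)
    have := free_e (fun k => (k == i)%:R - (k == j)%:R).
    have -> : \sum_(k < n) ((k == i)%:R - (k == j)%:R) *: e k = e i - e j.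
      under eq_bigr do rewrite scalerBl.
      rewrite sumrB (bigD1 i) //= [in X in _ - X](bigD1 j) //= !eqxx !scale1r.
      by rewrite !big1 ?addr0 // => k /negbTE ->; rewrite scale0r.
    rewrite eij subrr => /(_ erefl i).
    rewrite eqxx (_ : (i == j) = false) ?subr0; last exact/eqP.
    by move/eqP; rewrite oner_eq0.
  exists (range e); split; last first.
    rewrite (card_eqr card_II); apply: inj_card_eq => i j _ _; exact: inj_e.
  split; last first.
    apply/seteqP; split=> x /=; last first.
      by move=> /We[c ->]; exists n, e, c; split=> // i; exists i.
    move=> [m [e' [c [/(_ _)/cid2-/all_sig2[g _ ge] ->]]]]; apply/We.
    have ge' i : e' i = e (g i) by rewrite ge.
    under eq_bigr do rewrite ge'.
    by rewrite sum_reindex; eexists.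
  move=> m e' c inj_e' /(_ _)/cid2-/all_sig2[g _ ge].
  have ge' i : e' i = e (g i) by rewrite ge.
  under eq_bigr do rewrite ge'.
  rewrite sum_reindex => /free_e ec i; have := ec (g i).
  rewrite (big_pred1 i) // => j /=; apply/eqP/eqP => [gij|-> //].
  by apply: inj_e'; rewrite !ge' gij.
exists e; split=> [c ec i|x].
  by apply: (freeB _ e c) => // j; apply/Be; exists j.
split=> [[m [e' [c [/(_ _)/Be/cid-/all_sig[g ge] ->]]]]|[c ->]].
  by under eq_bigr do rewrite ge; rewrite sum_reindex; eexists.
by exists n, e, c; split=> // i; apply/Be; exists i.
Qed.

Lemma has_ldim_subspace W n : has_ldim W n -> is_subspace W.
Proof.
move=> /has_ldimP[e [_ We]]; split.
  by apply/We; exists (fun=> 0); rewrite big1 // => i _; rewrite scale0r.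
move=> a x y /We[c ->] /We[d ->]; apply/We; exists (fun i => a * c i + d i).
rewrite scaler_sumr -big_split /=; apply: eq_bigr => i _.
by rewrite scalerDl scalerA.
Qed.

Section Subspace.
Variable W : set V.
Hypothesis sW : is_subspace W.

Lemma subspaceZ a x : W x -> W (a *: x).
Proof. by case: sW => W0 WD Wx; rewrite -[_ *: _]addr0; exact: WD. Qed.

Lemma subspaceD x y : W x -> W y -> W (x + y).
Proof. by case: sW => _ WD Wx Wy; rewrite -[x]scale1r; exact: WD. Qed.

Lemma subspaceN x : W x -> W (- x).
Proof. by rewrite -scaleN1r; exact: subspaceZ. Qed.

Lemma subspaceB x y : W x -> W y -> W (x - y).
Proof. by move=> Wx /subspaceN; exact: subspaceD. Qed.

Lemma subspace_sum (I : finType) (f : I -> V) :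
  (forall i, W (f i)) -> W (\sum_i f i).
Proof.
by move=> Wf; elim/big_ind: _ => // [|x y]; [case: sW|exact: subspaceD].
Qed.

End Subspace.

End Bases.

(** * Linear algebra over a skew field: bases of spans and rank factorisation *)

Section SkewBases.
Variable F : unitRingType.
Hypothesis skewF : skew_field F.

(** Induction on the number of generators: a basis for the span of the last n is kept if it spans
    [e ord0], and is enlarged by [e ord0] otherwise. In the second case a relation with a nonzero
    coefficient at [e ord0] could be solved for it by division. *)
Lemma span_has_ldim (V : lmodType F) n (e : 'I_n -> V) : exists m,
  has_ldim [set \sum_(i < n) c i *: e i | c in [set: 'I_n -> F]] m.
Proof.
elim: n e => [|n IHn] e.
  exists 0%N; apply/has_ldimP; exists e; split=> [c _ []//|x].
  by split=> [[c _ <-]|[c ->]]; exists c.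
have [m /has_ldimP[b [free_b Wb]]] := IHn (fun i => e (lift ord0 i)).
have [[c e0]|e0] := pselect (exists c, e ord0 = \sum_(i < m) c i *: b i).
  exists m; apply/has_ldimP; exists b; split=> // x; split.
    move=> [d _ <-]; rewrite big_ord_recl.
    have /Wb[d' ->] : [set \sum_(i < n) c i *: e (lift ord0 i)
        | c in [set: 'I_n -> F]] (\sum_(i < n) d (lift ord0 i) *: e (lift ord0 i)).
      by exists (fun i => d (lift ord0 i)).
    exists (fun i => d ord0 * c i + d' i).
    rewrite e0 scaler_sumr -big_split; apply: eq_bigr => i _ /=.
    by rewrite scalerDl scalerA.
  move=> /Wb[d _ <-]; exists (fun i => oapp d 0 (unlift ord0 i)) => //.
  rewrite big_ord_recl unlift_none scale0r add0r.
  by apply: eq_bigr => i _; rewrite liftK.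
exists m.+1; apply/has_ldimP.
(* [unlift ord0 i] is [None] only at [ord0], so this family is [e ord0] followed by [b]. *)
exists (fun i => oapp b (e ord0) (unlift ord0 i)); split=> [c|x].
  rewrite big_ord_recl unlift_none /=.
  under eq_bigr do rewrite liftK /=.
  move=> ec; have c0 : c ord0 = 0.
    apply/eqP; apply: contra_notT e0 => /skewF c0.
    exists (fun i => - (c ord0)^-1 * c (lift ord0 i)).
    under eq_bigr do rewrite -scalerA.
    rewrite -scaler_sumr (_ : \sum_(i < m) _ = - (c ord0 *: e ord0)).
      by rewrite scaleNr scalerN opprK scalerA mulVr ?scale1r.
    by apply/eqP; rewrite -addr_eq0 addrC ec.
  move: ec; rewrite c0 scale0r add0r => /free_b ec i.
  by case: (unliftP ord0 i) => [j ->|->]; [exact: ec|].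
split=> [[c _ <-]|[c ->]].
  have /Wb[d ed] : [set \sum_(i < n) c i *: e (lift ord0 i)
      | c in [set: 'I_n -> F]] (\sum_(i < n) c (lift ord0 i) *: e (lift ord0 i)).
    by exists (fun i => c (lift ord0 i)).
  exists (fun i => oapp d (c ord0) (unlift ord0 i)).
  rewrite big_ord_recl ed big_ord_recl unlift_none /=; congr (_ + _).
  by apply: eq_bigr => i _; rewrite liftK.
have /Wb[d _ ed] : exists d, \sum_(i < m) c (lift ord0 i) *: b i
   = \sum_(i < m) d i *: b i by exists (fun i => c (lift ord0 i)).
exists (fun i => oapp d (c ord0) (unlift ord0 i)) => //.
rewrite big_ord_recl [RHS]big_ord_recl !unlift_none /=; congr (_ + _).
under [RHS]eq_bigr do rewrite liftK /=.
by rewrite -ed; apply: eq_bigr => i _; rewrite liftK.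
Qed.

(** Elimination by induction on the rows. Given a right inverse [E'] of the lower rows [Q'],
    subtracting a combination of them from the top row [q] leaves a nonzero row [q'] with
    [q' *m E' = 0]; an invertible entry of [q'] yields the missing column. *)
Lemma free_rows_right_inverse r n (Q : 'M[F]_(r, n)) :
  (forall u : 'rV_r, u *m Q = 0 -> u = 0) -> exists E, Q *m E = 1%:M.
Proof.
elim: r Q => [|r IHr]; first by exists 0; apply/matrixP=> - [].
rewrite -[r.+1]add1n => Q freeQ.
pose q := usubmx Q; pose Q' := dsubmx Q.
have eQ : Q = col_mx q Q' by rewrite /q /Q' vsubmxK.
have [u uQ0|E' QE'] := IHr Q'.
  have : row_mx 0 u *m Q = 0 by rewrite eQ mul_row_col mul0mx add0r.
  by move=> /freeQ; rewrite -(row_mx0 _ 1 1 r) => /eq_row_mx[].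
pose q' := q - q *m E' *m Q'.
have q'E' : q' *m E' = 0 by rewrite mulmxBl -[_ *m Q' *m E']mulmxA QE' mulmx1 subrr.
(* If [q'] vanished, the row (1, - q E') would be a relation between the rows of [Q]. *)
have [j q'j] : exists j, q' 0 j != 0.
  apply: contrapT => q'0.
  have : row_mx 1%:M (- (q *m E')) *m Q = 0.
    rewrite eQ mul_row_col mul1mx mulNmx; apply/rowP=> j.
    by rewrite [RHS]mxE; apply/eqP; apply: contra_notT q'0 => q'j; exists j.
  move=> /freeQ; rewrite -(row_mx0 _ 1 1 r) => /eq_row_mx[/matrixP/(_ 0 0)].
  by rewrite !mxE eqxx => /eqP; rewrite oner_eq0.
pose f : 'cV[F]_n := \col_i (if i == j then (q' 0 j)^-1 else 0).
have q'f : q' *m f = 1%:M.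
  apply/matrixP=> a b; rewrite !ord1 [LHS]mxE (bigD1 j) //= big1.
    by rewrite !mxE !eqxx addr0; have := divrr (skewF q'j); rewrite !mxE.
  by move=> i /negbTE ij; rewrite [f _ _]mxE ij mulr0.
(* This correction makes [Q'] kill the column and, since [q' *m E' = 0], keeps its product with [q']
   equal to 1. *)
pose f' := f - E' *m (Q' *m f).
have Q'f' : Q' *m f' = 0 by rewrite mulmxBr [Q' *m (E' *m _)]mulmxA QE' mul1mx subrr.
have qf' : q *m f' = 1%:M.
  have -> : q = q' + q *m E' *m Q' by rewrite subrK.
  rewrite mulmxDl -[_ *m Q' *m f']mulmxA Q'f' mulmx0 addr0.
  by rewrite mulmxBr q'f [q' *m (E' *m _)]mulmxA q'E' mul0mx subr0.
exists (row_mx f' (E' - f' *m (q *m E'))).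
rewrite eQ mul_col_row Q'f' qf' !mulmxBr QE' !mulmxA qf' Q'f' mul1mx subrr !mul0mx.
by rewrite subr0 -scalar_mx_block.
Qed.

(** The rows of [Q] form a basis of the row space, [P] holds the coordinates of the rows of [A], and
    [C] writes the basis back in terms of these rows. Then (C P - 1) Q = C A - Q = 0, and freeness
    of the rows of [Q] gives C P = 1. *)
Lemma mxrank_skew_factor k m (A : 'M[F]_(k, m)) :
  exists (P : 'M[F]_(k, mxrank_skew A)) (Q : 'M[F]_(mxrank_skew A, m)) C E,
  [/\ A = P *m Q, C *m P = 1%:M & Q *m E = 1%:M].
Proof.
have : has_ldim (range (fun u : 'rV[F]_k => u *m A)) (mxrank_skew A).
  rewrite /mxrank_skew /ldim; apply: xgetPex.
  have [r Hr] := span_has_ldim (fun i => row i A); exists r => /=.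
  congr (has_ldim _ r): Hr; apply/seteqP; split=> x /=.
    move=> [c _ <-]; exists (\row_i c i) => //; rewrite mulmx_sum_row.
    by apply: eq_bigr => i _; rewrite mxE.
  by move=> [u _ <-]; rewrite mulmx_sum_row; exists (fun i => u 0 i).
move: (mxrank_skew A) => r /has_ldimP[e [free_e We]].
pose Q : 'M[F]_(r, m) := \matrix_i e i.
have mulQ u : u *m Q = \sum_i u 0 i *: e i.
  by rewrite mulmx_sum_row; apply: eq_bigr => i _; rewrite rowK.
have freeQ (u : 'rV_r) : u *m Q = 0 -> u = 0.
  by rewrite mulQ => /free_e u0; apply/rowP=> i; rewrite u0 mxE.
have /(_ _)/cid-/all_sig[p pA] : forall i, exists p : 'rV_r, row i A = p *m Q.
  move=> i; have /We[c ->] : range (fun u : 'rV[F]_k => u *m A) (row i A).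
    by rewrite rowE; exists (delta_mx 0 i).
  by exists (\row_i c i); rewrite mulQ; apply: eq_bigr => j _; rewrite mxE.
have /(_ _)/cid-/all_sig[c cA] : forall i, exists c : 'rV_k, e i = c *m A.
  move=> i; have /We[u _ <-] : exists c, e i = \sum_(j < r) c j *: e j.
    exists (fun j => (j == i)%:R); rewrite (bigD1 i) //= eqxx scale1r big1 ?addr0 //.
    by move=> j /negbTE ->; rewrite scale0r.
  by exists u.
have [E QE] := free_rows_right_inverse freeQ.
pose P := \matrix_i p i; pose C := \matrix_i c i.
have AP : A = P *m Q by apply/row_matrixP=> i; rewrite row_mul rowK.
have QC : C *m A = Q by apply/row_matrixP=> i; rewrite row_mul !rowK.
exists P, Q, C, E; split=> //; apply/row_matrixP=> i; apply/eqP.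
rewrite -subr_eq0; apply/eqP/freeQ.
by rewrite mulmxBl -!row_mul mul1mx -mulmxA -AP QC subrr.
Qed.

End SkewBases.

(** * Dimension over the finite field [K] as a count of elements *)

Definition ffun_in (V : Type) (W : set V) N : set {ffun 'I_N -> V} :=
  [set x | forall i, W (x i)].

Definition col_in (V : Type) (W : set V) N : set 'cV[V]_N :=
  [set x | forall i, W (x i 0)].

Arguments ffun_in [V] W N _.
Arguments col_in [V] W N _.

Section Counting.
Variable K : finFieldType.

(** The enumeration [d] shows that [A] has |K|^n elements. For a subspace n is the dimension, but
    [A] may be any set, so that no linearity has to be carried along. *)
Definition qcard (T : Type) (A : set T) (n : nat) : Prop :=
  exists (I : finType) (d : I -> T),
  [/\ injective d, forall x, A x <-> exists i, x = d i & #|I| = (#|K| ^ n)%N].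

Lemma qcard_finite T (A : set T) n : qcard A n -> finite_set A.
Proof.
move=> [I [d [_ Ad _]]].
rewrite (_ : A = d @` setT); first exact/finite_image/finite_finset.
by apply/seteqP; split=> x; [move=> /Ad[i ->]; exists i
  |move=> [i _ <-]; apply/Ad; exists i].
Qed.

(** The comparison behind all dimension inequalities below: since |K| > 1, an injection compares the
    exponents. *)
Lemma qcard_le T U (A : set T) (B : set U) a b (f : T -> U) :
  qcard A a -> qcard B b -> (forall x, A x -> B (f x)) ->
  (forall x y, A x -> A y -> f x = f y -> x = y) -> (a <= b)%N.
Proof.
move=> [I [d [inj_d Ad cI]]] [J [e [_ Be cJ]]] fAB f_inj.
have Adi i : A (d i) by apply/Ad; exists i.
have /(_ _)/cid-/all_sig[g ge] i : exists j, f (d i) = e j by exact/Be/fAB.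
have /leq_card : injective g.
  by move=> i j gij; apply/inj_d/f_inj => //; rewrite !ge gij.
by rewrite cI cJ leq_exp2l // finNzRing_gt1.
Qed.

Lemma qcardX T U (A : set T) (B : set U) a b :
  qcard A a -> qcard B b -> qcard (A `*` B) (a + b).
Proof.
move=> [I [d [inj_d Ad cI]]] [J [e [inj_e Be cJ]]].
exists (I * J)%type, (fun k => (d k.1, e k.2)); split.
- by move=> [i j] [i' j'] [/inj_d -> /inj_e ->].
- move=> [x y]; split=> [[/Ad[i /= ->] /Be[j /= ->]]|[[i j] [-> ->]]].
    by exists (i, j).
  by split; [apply/Ad; exists i|apply/Be; exists j].
- by rewrite card_prod cI cJ expnD.
Qed.

Lemma qcard_ffun_in V (W : set V) n N : qcard W n -> qcard (ffun_in W N) (N * n).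
Proof.
move=> [I [d [inj_d Wd cI]]].
exists {ffun 'I_N -> I}, (fun k : {ffun 'I_N -> I} => [ffun i => d (k i)]); split.
- move=> k k' /ffunP kk'; apply/ffunP => i; apply: inj_d.
  by have := kk' i; rewrite !ffunE.
- move=> x; split=> [Wx|[k -> i]]; last by rewrite ffunE; apply/Wd; exists (k i).
  have /(_ _)/cid-/all_sig[g ge] i : exists j, x i = d j by exact/Wd/Wx.
  by exists [ffun i => g i]; apply/ffunP=> i; rewrite !ffunE.
- by rewrite card_ffun cI card_ord -expnM mulnC.
Qed.

Lemma qcard_col_in V (W : set V) n N : qcard W n -> qcard (col_in W N) (N * n).
Proof.
move=> /(qcard_ffun_in N)[I [d [inj_d Wd cI]]].
exists I, (fun k => \col_i d k i); split=> // [k k' /colP kk'|x].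
  by apply/inj_d/ffunP=> i; have := kk' i; rewrite !mxE.
split=> [Wx|[k -> i]]; last by rewrite mxE; apply: (Wd (d k)).2; exists k.
have /Wd[k kx] : ffun_in W N [ffun i => x i 0] by move=> i; rewrite ffunE.
by exists k; apply/colP=> i; rewrite mxE -kx ffunE.
Qed.

Lemma fieldK_skew : skew_field K.
Proof. by move=> x x0; rewrite unitfE. Qed.

Section Dim.
Variable V : lmodType K.
Implicit Types W : set V.

(** Over a finite field this amounts to finite dimension, and it is easier to check. *)
Definition fsub W := finite_set W /\ is_subspace W.

Lemma has_ldim_qcard W n : has_ldim W n -> qcard W n.
Proof.
move=> /has_ldimP[e [free_e We]].
exists {ffun 'I_n -> K}, (fun c : {ffun 'I_n -> K} => \sum_(i < n) c i *: e i); split.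
- move=> c d cd; apply/ffunP => i; apply/eqP; rewrite -subr_eq0; apply/eqP.
  move: i; apply: (free_e (fun i => c i - d i)).
  by under eq_bigr do rewrite scalerBl; rewrite sumrB cd subrr.
- move=> x; rewrite We; split=> [[c ->]|[c ->]]; last by exists c.
  by exists [ffun i => c i]; apply: eq_bigr => i _; rewrite ffunE.
- by rewrite card_ffun card_ord.
Qed.

(** The list of all elements of [W] is a finite spanning family. *)
Lemma fsub_has_ldim W : fsub W -> has_ldim W (ldim W).
Proof.
move=> [/finite_seqP[s Ws] sW]; rewrite /ldim; apply: xgetPex.
have [m Hm] := span_has_ldim fieldK_skew (fun i : 'I_(size s) => s`_i).
exists m => /=; congr (has_ldim _ m): Hm; apply/seteqP; split=> x /=.
  move=> [c _ <-]; apply: subspace_sum => // i; apply: subspaceZ => //.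
  by rewrite Ws /= mem_nth.
rewrite Ws /= => xs; have sx : (index x s < size s)%N by rewrite index_mem.
exists (fun i => (i == Ordinal sx)%:R) => //.
rewrite (bigD1 (Ordinal sx)) //= eqxx scale1r big1 ?addr0 ?nth_index //.
by move=> i /negbTE ->; rewrite scale0r.
Qed.

Lemma fsub_qcard W : fsub W -> qcard W (ldim W).
Proof. by move=> /fsub_has_ldim /has_ldim_qcard. Qed.

Lemma finite_ldim_fsub W : finite_ldim W -> fsub W.
Proof.
move=> [n Hn]; split; last exact: has_ldim_subspace Hn.
exact: qcard_finite (has_ldim_qcard Hn).
Qed.

Lemma ldim_mono W W' : fsub W -> fsub W' -> W `<=` W' -> (ldim W <= ldim W')%N.
Proof.
move=> /fsub_qcard cW /fsub_qcard cW' WW'.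
by apply: (qcard_le (f := id)) cW cW' _ _.
Qed.

Lemma ldim_gt0 W w : fsub W -> W w -> w != 0 -> (0 < ldim W)%N.
Proof.
move=> fW Ww w0; rewrite lt0n; apply/eqP => W0.
have [I [d [inj_d Wd]]] := fsub_qcard fW; rewrite W0 expn0 => /eqP/fintype1P[i Ii].
have [/Wd[j ej] /Wd[k ek]] : W w /\ W 0 by case: fW => _ [].
by move: w0; rewrite ej ek (Ii j) (Ii k) eqxx.
Qed.

End Dim.
End Counting.

(** * Growth of subspaces of [D] under left multiplication, and tilings by right translates *)

Section Growth.
Variables (K : finFieldType) (D : unitAlgType K).
Implicit Types (U W Z : set D) (s : seq D).

(** This is W + a_1 W + ... + a_r W; for a one-element list it is literally the set in the
    definition of amenability. *)
Fixpoint ext W s : set D :=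
  if s is a :: s' then [set x + a * y | x in ext W s' & y in W] else W.

(** The interior of [W] relative to [s]: candidates for right translations that keep [s] inside
    [W]. *)
Definition inner W s : set D := [set d | W d /\ forall v, v \in s -> W (v * d)].

Lemma ext_fsub W s : fsub W -> fsub (ext W s).
Proof.
move=> fW; elim: s => [//|a s [fin_s sub_s]] /=; have [finW subW] := fW.
split; first exact: finite_image2.
split=> [|b _ _ [x Wx [y Wy <-]] [x' Wx' [y' Wy' <-]]].
  by exists 0; [case: sub_s|exists 0; [case: subW|rewrite mulr0 addr0]].
exists (b *: x + x'); first by case: sub_s => _; apply.
exists (b *: y + y'); first by case: subW => _; apply.
by rewrite scalerDr mulrDr scalerAr addrACA.
Qed.

Lemma sub_ext W s : fsub W -> W `<=` ext W s.
Proof.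
move=> fW; elim: s => [//|a s IHs] x Wx.
by exists x; [exact: IHs|exists 0; [case: fW => _ []|rewrite mulr0 addr0]].
Qed.

Lemma ext_mul W s a y : fsub W -> a \in s -> W y -> ext W s (a * y).
Proof.
move=> fW + Wy; elim: s => [//|b s IHs]; rewrite inE => /orP[/eqP <-|/IHs say].
  exists 0; first by case: (ext_fsub s fW) => _ [].
  by exists y => //; rewrite add0r.
by exists (a * y) => //; exists 0; [case: fW => _ []|rewrite mulr0 addr0].
Qed.

(** The two spaces on the right have sum [ext W (a :: s)], and their intersection contains [W]. *)
Lemma ext_cons_le W s a : fsub W ->
  (ldim (ext W (a :: s)) + ldim W <= ldim (ext W s) + ldim (ext W [:: a]))%N.
Proof.
move=> fW; have fe t := ext_fsub t fW.
(* Decompositions are chosen for use in an injection; outside the space the value 0 is a mere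
   placeholder, as in the similar choices below. *)
have dec z : exists p : D * D,
    ext W (a :: s) z -> [/\ ext W s p.1, W p.2 & z = p.1 + a * p.2].
  have [[x ex [y Wy <-]]|nz] := pselect (ext W (a :: s) z); last by exists 0.
  by exists (x, y).
have [p p_dec] := boolp.choice dec.
(* With z = x + a w the chosen decomposition, (z, y) goes to (x + y, - y + a w). The sum of the
   components is z, which fixes x and w, and then y. *)
apply: (qcard_le (f := fun zy : D * D =>
  ((p zy.1).1 + zy.2, - zy.2 + a * (p zy.1).2))
  (qcardX (fsub_qcard (fe (a :: s))) (fsub_qcard fW))
  (qcardX (fsub_qcard (fe s)) (fsub_qcard (fe [:: a])))).
- move=> [z y] [/= /p_dec[es Ws _] Wy]; split=> /=.
    by apply: subspaceD => //; [exact: (fe s).2|exact: sub_ext].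
  by exists (- y); [exact: subspaceN (proj2 fW) _ _|exists (p z).2].
- move=> [z y] [z' y'] [/= /p_dec[_ _ ez] _] [/= /p_dec[_ _ ez'] _] [e1 e2].
  have zz' : z = z'.
    have e (x u b : D) : x + b = (x + u) + (- u + b) by rewrite addrA addrK.
    by rewrite ez ez' (e _ y) (e (p z').1 y') e1 e2.
  by rewrite zz' in e1 *; move/addrI: e1 => ->.
Qed.

Lemma inner_fsub W s : fsub W -> fsub (inner W s).
Proof.
move=> [finW subW]; split; first by apply: sub_finite_set finW => d [].
split=> [|a x y [Wx sx] [Wy sy]].
  by split=> [|v _]; rewrite ?mulr0; case: subW.
split; first by case: subW => _; apply.
move=> v vs; rewrite mulrDr -scalerAr.
by case: subW => _; apply; [exact: sx|exact: sy].
Qed.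

(** Left multiplication by [v] maps [inner W s] to (W + v W) / W with kernel [inner W (v :: s)]. *)
Lemma inner_cons_le W s v : fsub W ->
  (ldim (inner W s) + ldim W <= ldim (inner W (v :: s)) + ldim (ext W [:: v]))%N.
Proof.
move=> fW; have fi t := inner_fsub t fW.
have dec x : exists p : D * D, (exists p' : D * D, [/\ inner W s p'.1, W p'.2 &
    x = p'.2 + v * p'.1]) -> [/\ inner W s p.1, W p.2 & x = p.2 + v * p.1].
  by have [[p Hp]|nx] := pselect (exists p' : D * D, [/\ inner W s p'.1, W p'.2 &
    x = p'.2 + v * p'.1]); [exists p|exists 0].
have [p p_dec] := boolp.choice dec.
pose sg (zw : D * D) := zw.2 + v * zw.1.
have p_sg zw : inner W s zw.1 -> W zw.2 -> [/\ inner W s (p (sg zw)).1,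
    W (p (sg zw)).2 & sg zw = (p (sg zw)).2 + v * (p (sg zw)).1].
  by move=> sz Ww; apply: p_dec; exists zw.
have sW := proj2 fW.
(* Two pairs with the same value of w + v z have first components that differ by an element of
   [inner W (v :: s)]; the difference to the chosen pair is recorded next to that value. *)
apply: (qcard_le (f := fun zw : D * D => (zw.1 - (p (sg zw)).1, sg zw))
  (qcardX (fsub_qcard (fi s)) (fsub_qcard fW))
  (qcardX (fsub_qcard (fi (v :: s))) (fsub_qcard (ext_fsub [:: v] fW)))).
- move=> [z w] [/= sz Ww]; split=> /=; last by exists w => //; exists z => //; case: sz.
  have [sp Wp esg] := p_sg (z, w) sz Ww.
  have [Wd sd] : inner W s (z - (p (sg (z, w))).1).
    exact: subspaceB (proj2 (fi s)) _ _ sz sp.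
  split=> // u; rewrite inE => /orP[/eqP ->|/sd //].
  have -> : v * (z - (p (sg (z, w))).1) = (p (sg (z, w))).2 - w.
    rewrite mulrBr; apply/eqP; rewrite subr_eq addrAC -esg /sg /=.
    by rewrite addrAC subrr add0r.
  exact: subspaceB.
- move=> [z w] [z' w'] _ _ [/= e1 e2]; rewrite e2 in e1; move/addIr: e1 => zz'.
  by move: e2; rewrite /sg zz' /= => /addIr ->.
Qed.

Hypothesis skewD : skew_field D.

Definition independent_translates U k (d : 'I_k -> D) : Prop :=
  forall u : 'I_k -> D, (forall i, U (u i)) -> \sum_i u i * d i = 0 ->
  forall i, u i = 0.

(* For a maximal independent family d_1, ..., d_k of right translates of U inside
   W, each z in Z is -u^-1 (u_1 d_1 + ... + u_k d_k) for some u, u_1, ..., u_k in U;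
   as K is finite, counting these tuples bounds the dimension of Z. *)
Lemma tiling U W Z : fsub U -> fsub W -> fsub Z -> (exists2 u, U u & u != 0) ->
  (forall u z, U u -> Z z -> W (u * z)) ->
  exists k (d : 'I_k -> D), [/\ forall i, Z (d i), independent_translates U d &
    (ldim Z <= k.+1 * ldim U)%N].
Proof.
move=> fU fW fZ [u0 Uu0 u0n0] UZW.
pose P k := exists d : 'I_k -> D,
  (forall i, Z (d i)) /\ independent_translates U d.
have exP : exists k, `[< P k >].
  exists 0%N; apply/asboolP; exists (fun=> 0).
  by split=> [[]//|u _ _ []].
(* Independent translates inside [W] have total dimension k dim U <= dim W, and dim U >= 1; hence a
   maximal k exists. *)
have ubP k : `[< P k >] -> (k <= ldim W)%N.
  move=> /asboolP[d [Zd inddd]].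
  suff: (k * ldim U <= ldim W)%N.
    by apply: leq_trans; rewrite leq_pmulr // (ldim_gt0 fU Uu0).
  apply: (qcard_le (f := fun u : {ffun 'I_k -> D} => \sum_i u i * d i)
    (qcard_ffun_in k (fsub_qcard fU)) (fsub_qcard fW)).
    by move=> u Uu; apply: subspace_sum (proj2 fW) _ _ _ => i; exact: UZW.
  move=> u u' Uu Uu' /eqP; rewrite -subr_eq0 -sumrB => /eqP uu'.
  apply/ffunP => i; apply/eqP; rewrite -subr_eq0; apply/eqP; move: i.
  apply: (inddd (fun i => u i - u' i)).
    by move=> i; apply: subspaceB (proj2 fU) _ _ _ _.
  by rewrite -[RHS]uu'; apply: eq_bigr => i _; rewrite mulrBl.
case: (ex_maxnP exP ubP) => k /asboolP[d [Zd indd]] k_max.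
exists k, d; split=> //.
have dep z : exists p : D * {ffun 'I_k -> D}, Z z ->
    [/\ U p.1, p.1 != 0, ffun_in U k p.2 & p.1 * z = - \sum_i p.2 i * d i].
  have [z0|z0] := eqVneq z 0.
    exists (u0, 0) => _; split=> //=; first by move=> i; rewrite ffunE; case: fU => _ [].
    by rewrite z0 mulr0 big1 ?oppr0 // => i _; rewrite ffunE mul0r.
  have [Zz|nZz] := pselect (Z z); last by exists (u0, 0).
  (* Without such a relation for z, putting z in front of [d] would give a longer independent
     family. *)
  apply: contrapT => nex; suff : P k.+1 by move=> /asboolP /k_max; rewrite ltnn.
  exists (fun i => oapp d z (unlift ord0 i)); split.
    by move=> i; case: (unlift ord0 i).
  move=> u Uu; rewrite big_ord_recl unlift_none /=.
  under eq_bigr do rewrite liftK /=.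
  move=> uz; have u00 : u ord0 = 0.
    apply: contrapT => /eqP u00; apply: nex.
    exists (u ord0, [ffun i => u (lift ord0 i)]) => _; split=> //=.
      by move=> i; rewrite ffunE.
    by under eq_bigr do rewrite ffunE; apply/eqP; rewrite -addr_eq0 uz.
  move: uz; rewrite u00 mul0r add0r => /(indd (fun i => u (lift ord0 i))) ul i.
  by case: (unliftP ord0 i) => [j ->|->]; [apply: ul => ?; exact: Uu|].
have [p p_dep] := boolp.choice dep.
rewrite mulSn; apply: (qcard_le (f := p) (fsub_qcard fZ)
  (qcardX (fsub_qcard fU) (qcard_ffun_in k (fsub_qcard fU)))).
  by move=> z /p_dep[].
move=> z z' /p_dep[_ pz _ ez] /p_dep[_ _ _ ez'] pp'.
by rewrite -pp' -ez in ez'; apply: (mulrI (skewD pz)).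
Qed.

End Growth.

(** * Generated submodules, and the [R]-module D^l defined by [rho] *)

Section SpanModule.
Variables (R : nzRingType) (E : lmodType R) (B : set E).

Definition lspan_pred : {pred E} := fun x => x \in lspan B.

Lemma sub_lspan : B `<=` lspan B.
Proof.
move=> x Bx; exists 1%N, (fun=> x), (fun=> 1); split=> //.
by rewrite big_ord1 scale1r.
Qed.

Lemma lspan_subspace : is_subspace (lspan B).
Proof.
split; first by exists 0%N, (fun=> 0), (fun=> 0); split=> [[]|]; rewrite ?big_ord0.
move=> a _ _ [m [e [c [Be ->]]]] [n [f [d [Bf ->]]]].
exists (m + n)%N, (fun i : 'I_(m + n) => match fintype.split i with inl j => e j | inr j => f j end),
  (fun i : 'I_(m + n) => match fintype.split i with inl j => a * c j | inr j => d j end).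
split; first by move=> i; case: (fintype.split i).
rewrite big_split_ord /= scaler_sumr; congr (_ + _); apply: eq_bigr => i _.
  by rewrite (unsplitK (inl i)) scalerA.
by rewrite (unsplitK (inr i)).
Qed.

Lemma lspan_min (C : set E) : is_subspace C -> B `<=` C -> lspan B `<=` C.
Proof.
move=> sC BC _ [n [e [c [Be ->]]]]; apply: subspace_sum => // i.
by apply: subspaceZ => //; exact: BC.
Qed.

Fact lspan_closed : submod_closed lspan_pred.
Proof.
split; first by apply/mem_set; case: lspan_subspace.
move=> a x y /set_mem sx /set_mem sy; apply/mem_set.
by case: lspan_subspace => _; apply.
Qed.
HB.instance Definition _ := GRing.isSubmodClosed.Build R E lspan_pred lspan_closed.

Record lspan_mod := LspanMod {lspan_val :> E; _ : lspan_val \in lspan_pred}.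
HB.instance Definition _ := [isSub for lspan_val].
HB.instance Definition _ := [Choice of lspan_mod by <:].
HB.instance Definition _ := [SubChoice_isSubLmodule of lspan_mod by <:].

Lemma lspan_valP (x : lspan_mod) : lspan B (val x).
Proof. by apply: set_mem; exact: valP. Qed.

Lemma lspan_insub (x : E) : lspan B x -> exists y : lspan_mod, val y = x.
Proof. by move=> /mem_set Bx; exists (Sub x Bx); rewrite SubK. Qed.

End SpanModule.

Section RepModule.
Variables (R : nzRingType) (D : nzRingType) (l : nat).

(** [R] acts on columns from the left through [rho], so right multiplication by an element of [D] is
    [R]-linear. *)
Definition repmod (rho : {rmorphism R -> 'M[D]_l}) : Type := 'cV[D]_l.

Variable rho : {rmorphism R -> 'M[D]_l}.
HB.instance Definition _ := GRing.Zmodule.on (repmod rho).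

Definition repmod_scale (a : R) (v : repmod rho) : repmod rho := rho a *m v.

Fact repmod_scaleA a b v :
  repmod_scale a (repmod_scale b v) = repmod_scale (a * b) v.
Proof. by rewrite /repmod_scale rmorphM mulmxA. Qed.
Fact repmod_scale1 : left_id 1 repmod_scale.
Proof. by move=> v; rewrite /repmod_scale rmorph1 mul1mx. Qed.
Fact repmod_scaleDr : right_distributive repmod_scale +%R.
Proof. by move=> a v w; rewrite /repmod_scale mulmxDr. Qed.
Fact repmod_scaleDl v : {morph repmod_scale^~ v : a b / a + b}.
Proof. by move=> a b; rewrite /repmod_scale raddfD mulmxDl. Qed.

HB.instance Definition _ := GRing.Zmodule_isLmodule.Build R (repmod rho)
  repmod_scaleA repmod_scale1 repmod_scaleDr repmod_scaleDl.

Lemma repmodZE a (v : repmod rho) : a *: v = rho a *m v.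
Proof. by []. Qed.

Definition genmod (W : set D) := lspan_mod (col_in W l : set (repmod rho)).
HB.instance Definition _ W := GRing.Lmodule.on (genmod W).

End RepModule.

(** * Dimension of the module generated by W^l *)

Section Restriction.
Variables (K : finFieldType) (R : algType K) (M : lmodType R).

Lemma restr_subspace (W : set M) : W 0 ->
  (forall x y, W x -> W y -> W (x + y)) -> (forall (a : R) x, W x -> W (a *: x)) ->
  is_subspace (W : set (restr M)).
Proof. by move=> W0 WD WZ; split=> // a x y Wx Wy; apply: (WD _ _ (WZ _ _ Wx)). Qed.

End Restriction.

Section GeneratedModule.
Variables (K : finFieldType) (R : falgType K) (D : unitAlgType K) (l : nat).
Variable rho : {rmorphism R -> 'M[D]_l}.
Hypothesis rhoZ : forall (a : K) (x : R), rho (a *: x) = map_mx ( *:%R a) (rho x).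
Implicit Types W : set D.

Definition entries m n (X : 'M[D]_(m, n)) : seq D :=
  codom (fun p : 'I_m * 'I_n => X p.1 p.2).

Lemma mulmx_ext W m n (X : 'M[D]_(m, n)) (v : 'cV_n) : fsub W ->
  col_in W n v -> col_in (ext W (entries X)) m (X *m v).
Proof.
move=> fW Wv i; rewrite mxE; apply: subspace_sum => [|j].
  exact: (ext_fsub _ fW).2.
by apply: ext_mul => //; exact: (codom_f (fun p => X p.1 p.2) (i, j)).
Qed.

(** The entries of [rho] on a [K]-basis of [R]; by linearity they span all entries of all matrices
    [rho x] over [K]. *)
Definition struct_coefs : seq D :=
  codom (fun p : 'I_(\dim {:R}) * ('I_l * 'I_l) =>
    rho (vbasis {:R})`_p.1 p.2.1 p.2.2).

(** Expanding the coefficients from [R] in the basis turns each coordinate into a [K]-combination of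
    products s w with s in [struct_coefs] and w in [W]. *)
Lemma lspan_sub_ext W : fsub W ->
  lspan (col_in W l : set (repmod rho)) `<=` col_in (ext W struct_coefs) l.
Proof.
move=> fW _ [n [e [c [We ->]]]] i; rewrite summxE.
have sE := (ext_fsub struct_coefs fW).2.
apply: subspace_sum => // k; rewrite repmodZE mxE.
rewrite (coord_vbasis (memvf (c k))) raddf_sum /=.
apply: subspace_sum => // j; rewrite summxE mulr_suml; apply: subspace_sum => // b.
rewrite rhoZ mxE -scalerAl; apply: subspaceZ => //; apply: ext_mul => //; last exact: We.
exact: (codom_f (fun p : 'I_(\dim {:R}) * ('I_l * 'I_l) =>
  rho (vbasis {:R})`_p.1 p.2.1 p.2.2) (b, (i, j))).
Qed.

Section Fixed.
Variable W : set D.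
Hypothesis fW : fsub W.
Local Notation M := (genmod rho W).
Local Notation W' := (ext W struct_coefs).

Lemma genmod_finite : finite_set [set: M].
Proof.
have fin := qcard_finite (qcard_col_in l (fsub_qcard (ext_fsub struct_coefs fW))).
apply: (@sub_finite_set _ _ ((fun x : M => val x : 'cV_l) @^-1` col_in W' l)).
  by move=> x _; apply/lspan_sub_ext/lspan_valP.
by apply: finite_preimage fin => x y _ _; exact: val_inj.
Qed.

Lemma genmod_fsub : fsub ([set: M] : set (restr M)).
Proof. by split; [exact: genmod_finite|exact: restr_subspace]. Qed.

Lemma genmod_qcard : qcard K [set: M] (kdim [set: M]).
Proof. exact: fsub_qcard genmod_fsub. Qed.

Lemma genmod_insub (v : 'cV[D]_l) : col_in W l v -> exists y : M, val y = v.
Proof. by move=> Wv; apply: lspan_insub; exact: sub_lspan. Qed.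

Lemma genmod_ffun_fsub k (A : set {ffun 'I_k -> M}) :
  A 0 -> (forall x y, A x -> A y -> A (x + y)) ->
  (forall (a : K) x, A x -> A ((a%:A : R) *: x)) ->
  fsub (A : set (restr {ffun 'I_k -> M})).
Proof.
move=> A0 AD AZ; split; last by split=> // a x y Ax Ay; apply: AD => //; exact: AZ.
apply: sub_finite_set (qcard_finite (qcard_ffun_in k genmod_qcard)).
by move=> x _ i.
Qed.

(** Lower half of the sandwich of [M] between W^l and W'^l. *)
Lemma kdim_genmod_ge : (l * ldim W <= kdim [set: M])%N.
Proof.
have /boolp.choice[f fv] v : exists y : M, col_in W l v -> val y = v.
  have [/genmod_insub[y <-]|nv] := pselect (col_in W l v); first by exists y.
  by exists 0.
apply: (qcard_le (f := f) (qcard_col_in l (fsub_qcard fW)) genmod_qcard) => //.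
by move=> v v' /fv vE /fv v'E fvv'; rewrite -vE -v'E fvv'.
Qed.

Lemma kdim_genmod_le : (kdim [set: M] <= l * ldim W')%N.
Proof.
apply: (qcard_le (f := fun x : M => val x : 'cV_l) genmod_qcard
  (qcard_col_in l (fsub_qcard (ext_fsub struct_coefs fW)))).
  by move=> x _; apply/lspan_sub_ext/lspan_valP.
by move=> x y _ _; exact: val_inj.
Qed.

(** * Ranks of matrices over [R] on the generated module *)

Section Rank.
Variables (k m : nat) (A : 'M[R]_(k, m)).
Local Notation B := (rho_mx rho A).

(** Embeds M^n into D^(n l), where the action of [A] becomes multiplication by [rho_mx rho A]. *)
Definition stack n (x : {ffun 'I_n -> M}) : 'cV[D]_(\sum_(j < n) l) :=
  \mxcol_j (val (x j) : 'cV_l).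

Lemma stack_inj n : injective (@stack n).
Proof.
move=> x y exy; apply/ffunP=> j; apply: val_inj.
by have := congr1 (fun z => submxcol z j) exy; rewrite /stack !mxcolK.
Qed.

Lemma stackD n : {morph @stack n : x y / x + y}.
Proof. by move=> x y; rewrite /stack -mxcolD; apply: eq_mxcol => j; rewrite ffunE. Qed.

Lemma stackN n : {morph @stack n : x / - x}.
Proof.
move=> x; rewrite /stack -mxcolN; apply: eq_mxcol => j.
by rewrite !ffunE raddfN.
Qed.

Lemma stack_act x : stack (mx_act A x) = B *m stack x.
Proof.
rewrite /rho_mx mxblockEh mul_mxrow_mxcol /stack.
under [RHS]eq_bigr do rewrite mxcol_mul.
rewrite -mxcol_sum; apply: eq_mxcol => i.
by rewrite ffunE raddf_sum; apply: eq_bigr.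
Qed.

Lemma unstack n (v : 'cV[D]_(\sum_(j < n) l)) : col_in W _ v ->
  exists x, stack x = v.
Proof.
move=> Wv; have /boolp.choice[f fv] j : exists y : M, val y = submxcol v j.
  by apply: genmod_insub => i; rewrite mxE.
exists [ffun j => f j]; rewrite -[RHS]submxcolK; apply: eq_mxcol => j.
by rewrite ffunE fv.
Qed.

Lemma range_fsub : fsub (range (@mx_act K R M k m A) : set (restr {ffun 'I_k -> M})).
Proof.
apply: genmod_ffun_fsub => [|_ _ [x _ <-] [y _ <-]|a _ [x _ <-]].
- exists 0 => //; apply/ffunP=> i; rewrite !ffunE big1 // => j _.
  by rewrite ffunE scaler0.
- exists (x + y) => //; apply/ffunP=> i; rewrite !ffunE -big_split.
  by apply: eq_bigr => j _; rewrite ffunE scalerDr.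
- exists ((a%:A : R) *: x) => //; apply/ffunP=> i; rewrite !ffunE scaler_sumr.
  by apply: eq_bigr => j _; rewrite ffunE !scalerA mulr_algr mulr_algl.
Qed.

Definition rk_num := kdim (range (@mx_act K R M k m A)).

Lemma range_qcard : qcard K (range (@mx_act K R M k m A)) rk_num.
Proof. exact: fsub_qcard range_fsub. Qed.

Variables (r : nat) (P : 'M[D]_(\sum_(i < k) l, r)) (Q : 'M[D]_(r, \sum_(j < m) l))
  (C : 'M[D]_(r, \sum_(i < k) l)) (E : 'M[D]_(\sum_(j < m) l, r)).
Hypotheses (BE : B = P *m Q) (CP : C *m P = 1%:M) (QE : Q *m E = 1%:M).

(** B = P Q kills all v in W^(m l) with Q v = 0, a space of dimension at least m l dim W - r dim
    ([ext W (entries Q)]). What remains of dim M^m bounds the rank. *)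
Lemma rk_num_le : (rk_num + m * l * ldim W
  <= r * ldim (ext W (entries Q)) + m * kdim [set: M])%N.
Proof.
have Nml : (\sum_(j < m) l = m * l)%N by rewrite sum_nat_const card_ord.
have /boolp.choice[s sE] (y : {ffun 'I_k -> M}) : exists x : {ffun 'I_m -> M},
    range (@mx_act K R M k m A) y -> mx_act A x = y.
  have [[x _ <-]|ny] := pselect (range (@mx_act K R M k m A) y); first by exists x.
  by exists 0.
have /boolp.choice[t tE] (z : 'cV[D]_r) : exists v : 'cV[D]_(\sum_(j < m) l),
    (exists2 v', col_in W _ v' & z = Q *m v') -> col_in W _ v /\ z = Q *m v.
  have [[v' Wv' ->]|nz] := pselect (exists2 v', col_in W _ v' & z = Q *m v').
    by exists v'.
  by exists 0.
have /boolp.choice[h hE] (v : 'cV[D]_(\sum_(j < m) l)) : exists x,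
    col_in W _ v -> stack x = v.
  have [/unstack[x <-]|nv] := pselect (col_in W _ v); first by exists x.
  by exists 0.
have tQ v : col_in W _ v -> col_in W _ (t (Q *m v)) /\ Q *m v = Q *m t (Q *m v).
  by move=> Wv; apply: tE; exists v.
(* [s], [t] and [h] are sections of the action of [A], of [Q] on columns over [W], and of [stack].
   As B kills v - t(Q v), applying B to the second component recovers y; with Q v known, v
   follows. *)
rewrite -Nml; apply: (qcard_le
  (f := fun yv : _ * _ => (Q *m yv.2, s yv.1 + (h yv.2 - h (t (Q *m yv.2)))))
  (qcardX range_qcard (qcard_col_in _ (fsub_qcard fW)))
  (qcardX (qcard_col_in r (fsub_qcard (ext_fsub (entries Q) fW)))
          (qcard_ffun_in m genmod_qcard))).
  by move=> [y v] [/= ry Wv]; split=> //=; exact: mulmx_ext.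
move=> [y v] [y' v'] [/= ry Wv] [/= ry' Wv'] [eQ /(congr1 (@stack m))].
have [Wt _] := tQ _ Wv; have [Wt' _] := tQ _ Wv'.
rewrite !stackD !stackN !hE // => e.
have Bt u : col_in W _ u -> B *m t (Q *m u) = B *m u.
  by move=> Wu; rewrite BE -!mulmxA -(tQ u Wu).2.
have yy' : y = y'.
  apply: stack_inj; have := congr1 (mulmx B) e.
  by rewrite !mulmxDr !mulmxN -!stack_act !sE // !Bt // !subrr !addr0.
by move: e; rewrite yy' eQ => /addrI /addIr ->.
Qed.

(** The image of W^(m l) under B has dimension m l dim W - dim N, with N the kernel of B on W^(m l).
    As B and Q have the same kernel and Q E = 1, N and E W^r form a direct sum inside the columns
    over [ext W (entries E)], which bounds dim N. *)
Lemma rk_num_ge : (r * ldim W + m * l * ldim W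
  <= rk_num + m * l * ldim (ext W (entries E)))%N.
Proof.
have Nml : (\sum_(j < m) l = m * l)%N by rewrite sum_nat_const card_ord.
have /boolp.choice[t tE] (z : 'cV[D]_(\sum_(i < k) l)) :
    exists v : 'cV[D]_(\sum_(j < m) l),
    (exists2 v', col_in W _ v' & z = B *m v') -> col_in W _ v /\ z = B *m v.
  have [[v' Wv' ->]|nz] := pselect (exists2 v', col_in W _ v' & z = B *m v').
    by exists v'.
  by exists 0.
have /boolp.choice[h hE] (v : 'cV[D]_(\sum_(j < m) l)) : exists x,
    col_in W _ v -> stack x = v.
  have [/unstack[x <-]|nv] := pselect (col_in W _ v); first by exists x.
  by exists 0.
have tB v : col_in W _ v -> col_in W _ (t (B *m v)) /\ B *m v = B *m t (B *m v).
  by move=> Wv; apply: tE; exists v.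
have sE := (ext_fsub (entries E) fW).2.
rewrite -Nml; apply: (qcard_le
  (f := fun yv : _ * _ => (mx_act A (h yv.2), E *m yv.1 + (yv.2 - t (B *m yv.2))))
  (qcardX (qcard_col_in r (fsub_qcard fW)) (qcard_col_in _ (fsub_qcard fW)))
  (qcardX range_qcard (qcard_col_in _ (fsub_qcard (ext_fsub (entries E) fW))))).
  move=> [y v] [/= Wy Wv]; split=> /=; first by exists (h v).
  move=> i; rewrite mxE; apply: subspaceD => //; first exact: mulmx_ext.
  by rewrite !mxE; apply: sub_ext => //; apply: subspaceB (fW.2) _ _ _ _ => //;
    apply: (tB v Wv).1.
move=> [y v] [y' v'] [/= Wy Wv] [/= Wy' Wv'] [/(congr1 (@stack k))].
rewrite !stack_act !hE // => eB.
(* The left inverse [C] of [P] turns equality of products by B into equality of products by Q. *)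
have Qt u : col_in W _ u -> Q *m t (B *m u) = Q *m u.
  move=> Wu; have [_] := tB u Wu; move/(congr1 (mulmx C)).
  by rewrite BE -!mulmxA !(mulmxA C) CP !mul1mx.
move=> e; have yy' : y = y'.
  by have := congr1 (mulmx Q) e; rewrite !mulmxDr !mulmxN !Qt // !subrr !addr0 !mulmxA QE !mul1mx.
by move: e; rewrite yy' eB => /addrI /addIr ->.
Qed.

End Rank.
End Fixed.
End GeneratedModule.

(** * Limits along a Foelner sequence *)

Section Folner.
Variables (Rr : realType) (K : finFieldType) (D : unitAlgType K).

Definition folner (W : nat -> set D) : Prop :=
  (forall n, fsub (W n) /\ exists2 w, W n w & w != 0) /\
  forall a, (fun n => (ldim (ext (W n) [:: a]))%:R / (ldim (W n))%:R : Rr)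
    @ \oo --> (1 : Rr).

Variable W : nat -> set D.
Hypothesis folW : folner W.
Local Notation w n := (ldim (W n)).
Local Notation ratio f := (fun n => (f n)%:R / (w n)%:R : Rr).

Let fW n : fsub (W n). Proof. by case: (folW.1 n). Qed.

Lemma folner_ldim_gt0 n : (0 < w n)%N.
Proof. by case: (folW.1 n) => fWn [x Wx]; exact: ldim_gt0. Qed.

Let w0 n : (w n)%:R != 0 :> Rr.
Proof. by rewrite pnatr_eq0 -lt0n folner_ldim_gt0. Qed.

Lemma ratio_le (a b : nat) n : (a <= b)%N ->
  a%:R / (w n)%:R <= b%:R / (w n)%:R :> Rr.
Proof. by move=> ab; rewrite ler_wpM2r ?invr_ge0 // ler_nat. Qed.

Lemma ratioD (a b : nat) n :
  (a + b)%:R / (w n)%:R = a%:R / (w n)%:R + b%:R / (w n)%:R :> Rr.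
Proof. by rewrite natrD mulrDl. Qed.

Lemma ratioM (a b : nat) n :
  (a * b)%:R / (w n)%:R = a%:R * (b%:R / (w n)%:R) :> Rr.
Proof. by rewrite natrM mulrA. Qed.

Lemma ratio_self n : (w n)%:R / (w n)%:R = 1 :> Rr.
Proof. exact: divff. Qed.

Lemma ratio_const (a : nat) n : a%:R = (a * w n)%:R / (w n)%:R :> Rr.
Proof. by rewrite ratioM ratio_self mulr1. Qed.

(** By [ext_cons_le] each further element a adds at most dim(W + a W) - dim W, which is o(dim W). *)
Lemma folner_ext s : ratio (fun n => ldim (ext (W n) s)) @ \oo --> (1 : Rr).
Proof.
elim: s => [|a s IHs].
  by under eq_cvg => n do rewrite /= ratio_self; exact: cvg_cst.
apply: (@squeeze_cvgr _ _ _ _ (fun=> 1) (fun n =>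
  (ldim (ext (W n) s))%:R / (w n)%:R + (ldim (ext (W n) [:: a]))%:R / (w n)%:R - 1)).
- apply: nearW => n; apply/andP; split.
    rewrite -[X in X <= _](ratio_self n); apply: ratio_le.
    by apply: ldim_mono => //; [exact: ext_fsub|exact: sub_ext].
  rewrite lerBrDr -[X in _ + X <= _](ratio_self n) -!ratioD.
  exact/ratio_le/ext_cons_le.
- exact: cvg_cst.
- rewrite -[X in _ --> X](addrK (1 : Rr)); apply: cvgB; last exact: cvg_cst.
  by apply: cvgD; [exact: IHs|exact: folW.2].
Qed.

(** By [inner_cons_le] each further element v costs at most dim(W + v W) - dim W. *)
Lemma folner_inner s : ratio (fun n => ldim (inner (W n) s)) @ \oo --> (1 : Rr).
Proof.
have le_inner t n : (ldim (inner (W n) t) <= w n)%N.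
  by apply: ldim_mono => // [|d []//]; exact: inner_fsub.
elim: s => [|v s IHs].
  under eq_cvg => n.
    rewrite (_ : inner (W n) [::] = W n); last by apply/seteqP; split=> [d []|].
    rewrite ratio_self. over.
  exact: cvg_cst.
apply: (@squeeze_cvgr _ _ _ _ (fun n =>
  (ldim (inner (W n) s))%:R / (w n)%:R + 1 - (ldim (ext (W n) [:: v]))%:R / (w n)%:R)
  (fun=> 1)).
- apply: nearW => n; apply/andP; split; last first.
    by rewrite -[X in _ <= X](ratio_self n); exact/ratio_le/le_inner.
  rewrite lerBlDr -[X in _ + X <= _](ratio_self n) -!ratioD.
  exact/ratio_le/inner_cons_le.
- rewrite -[X in _ --> X](addrK (1 : Rr)); apply: cvgB; last exact: folW.2.
  by apply: cvgD; [exact: IHs|exact: cvg_cst].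
- exact: cvg_cst.
Qed.

Hypothesis skewD : skew_field D.

(** For a nonzero x0 in W_n the products of x0 with many elements of [D] are distinct and lie in an
    extension of W_n of dimension eventually below 2 dim W_n. *)
Lemma folner_infinite c : infinite_set [set: D] -> \forall n \near \oo, (c <= w n)%N.
Proof.
(* The exponent 2c anticipates the ratio bound 2: 2c <= dim ([ext (W n) s]) < 2 dim W_n. *)
move=> infD; have [X _] := infinite_set_fset (#|K| ^ (2 * c)) infD.
have := finmap.fset_uniq X; move: (finmap.enum_fset X) => s us cs.
have q1 := finNzRing_gt1 K.
have : \forall n \near \oo,
    (ldim (ext (W n) s))%:R / (w n)%:R < 2 :> Rr.
  by apply: (cvgr_lt (1 : Rr)); [exact: folner_ext|rewrite ltr1n].
apply: filterS => n; rewrite ltr_pdivrMr ?ltr0n ?folner_ldim_gt0 //.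
rewrite -natrM ltr_nat => lt2.
have [_ [x0 Wx0 x0n0]] := folW.1 n.
have [I [d [_ extd cI]]] := fsub_qcard (ext_fsub s (fW n)).
have /boolp.choice[g gE] (k : 'I_(size s)) : exists i, s`_k * x0 = d i.
  by apply/extd/ext_mul => //; exact: mem_nth.
have /leq_card : injective g.
  move=> i j gij; apply/val_inj/eqP; rewrite -(nth_uniq 0 (ltn_ord i) (ltn_ord j) us).
  by apply/eqP/(mulIr (skewD x0n0)); rewrite !gE gij.
rewrite cI card_ord => /(leq_trans cs); rewrite leq_exp2l // => /leq_ltn_trans.
by move=> /(_ _ lt2); rewrite ltn_pmul2l // => /ltnW.
Qed.

Section Rank.
Variables (R : falgType K) (l : nat) (rho : {rmorphism R -> 'M[D]_l}).
Hypothesis rhoZ : forall (a : K) (x : R), rho (a *: x) = map_mx ( *:%R a) (rho x).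
Local Notation M n := (genmod rho (W n)).

Lemma ratio_genmod : ratio (fun n => kdim [set: M n]) @ \oo --> (l%:R : Rr).
Proof.
apply: (@squeeze_cvgr _ _ _ _ (fun=> l%:R) (fun n =>
  l%:R * ((ldim (ext (W n) (struct_coefs rho)))%:R / (w n)%:R))).
- apply: nearW => n; rewrite [X in X <= _ <= _](ratio_const l n) -ratioM.
  by apply/andP; split; apply: ratio_le;
    [exact: kdim_genmod_ge|exact: kdim_genmod_le].
- exact: cvg_cst.
- by rewrite -[X in _ --> X]mulr1; apply: cvgM; [exact: cvg_cst|exact: folner_ext].
Qed.

Hypothesis l0 : (0 < l)%N.

(** After division by dim W_n the numerator tends to r, the rank over [D], and the denominator to l
    > 0. *)
Lemma rk_mod_cvg k m (A : 'M[R]_(k, m)) :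
  (fun n => rk_mod Rr (M n) A) @ \oo --> rk_rep Rr rho A.
Proof.
have [P [Q [C [E [BE CP QE]]]]] := mxrank_skew_factor skewD (rho_mx rho A).
rewrite /rk_rep; move: (mxrank_skew _) => r in P Q C E BE CP QE *.
pose f n := (rk_num rho (W n) A)%:R / (w n)%:R : Rr.
have fr : f @ \oo --> (r%:R : Rr).
  (* Both bounds tend to r + m l - m l, the upper one because dim M_n / dim W_n tends to l. *)
  apply: (@squeeze_cvgr _ _ _ _
    (fun n => r%:R + (m * l)%:R
       - (m * l)%:R * ((ldim (ext (W n) (entries E)))%:R / (w n)%:R))
    (fun n => r%:R * ((ldim (ext (W n) (entries Q)))%:R / (w n)%:R)
       + m%:R * ((kdim [set: M n])%:R / (w n)%:R) - (m * l)%:R)).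
  - apply: nearW => n; apply/andP; split.
      rewrite lerBlDr [X in X + _ <= _](ratio_const r n).
      rewrite [X in _ + X <= _](ratio_const (m * l) n) -!ratioM -!ratioD.
      apply: ratio_le; exact: rk_num_ge BE CP QE.
    rewrite lerBrDr [X in _ + X <= _](ratio_const (m * l) n) -!ratioM -!ratioD.
    apply: ratio_le; exact: rk_num_le BE.
  - rewrite -[X in _ --> X](addrK ((m * l)%:R : Rr)).
    apply: cvgB; first exact: cvg_cst.
    by rewrite -[X in _ --> X]mulr1; apply: cvgM; [exact: cvg_cst|exact: folner_ext].
  - rewrite -[X in _ --> X](addrK ((m * l)%:R : Rr)); apply: cvgB; last exact: cvg_cst.
    rewrite [X in _ + X]natrM -[X in X + _]mulr1; apply: cvgD; apply: cvgM; try exact: cvg_cst.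
      exact: folner_ext.
    exact: ratio_genmod.
have -> : (fun n => rk_mod Rr (M n) A) =
    (fun n => f n / ((kdim [set: M n])%:R / (w n)%:R)).
  by apply/funext => n; rewrite /rk_mod /f invfM invrK mulrACA mulVf ?mulr1 // mulrC.
apply: cvgM; first exact: fr.
by apply: cvgV; [rewrite pnatr_eq0 -lt0n|exact: ratio_genmod].
Qed.

End Rank.
End Folner.

(** * A tiling criterion for hyperfiniteness *)

Lemma dsum_atP (R : nzRingType) (I : finType) (N : I -> lmodType R) a
  (x y : dsum N) i : dsum_at (a *: x + y) i = a *: dsum_at x i + dsum_at y i.
Proof.
apply: etrans (dsum_ofE (fun i => dsum_at (a *: x) i + dsum_at y i) i) _.
by congr (_ + _); exact: (dsum_ofE (fun i => a *: dsum_at x i) i).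
Qed.

Section HyperfiniteCriterion.
Variables (Rr : realType) (K : fieldType) (R : algType K).

Definition tile_map (U M : lmodType R) k (h : 'I_k -> {linear U -> M})
  (u : {ffun 'I_k -> U}) : M := \sum_i h i (u i).

Lemma tile_mapP (U M : lmodType R) k (h : 'I_k -> {linear U -> M}) a u v :
  tile_map h (a *: u + v) = a *: tile_map h u + tile_map h v.
Proof.
rewrite /tile_map scaler_sumr -big_split; apply: eq_bigr => i _.
by rewrite !ffunE linearP.
Qed.

(** [U] is tied to [N i0] by an equation because [hyperfinite_tiles] defines its family [N] by a
    conditional. *)
Lemma dsum_tile_map t (N : 'I_t -> lmodType R) i0 (U M : lmodType R) k
    (h : 'I_k -> {linear U -> M}) : N i0 = U -> injective (tile_map h) ->
  exists (alpha : 'I_t -> nat)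
    (f : {linear dsum (fun i => {ffun 'I_(alpha i) -> N i}) -> M}),
    injective f /\ range f = range (tile_map h).
Proof.
move=> e; case: U / e h => h inj_h.
(* The multiplicity is k at [i0] and 0 elsewhere, where the power of [N i] is trivial. *)
pose alpha i := (k * (i == i0))%N; exists alpha.
have ek : k = alpha i0 by rewrite /alpha eqxx muln1.
pose V := dsum (fun i => {ffun 'I_(alpha i) -> N i}).
pose p (x : V) : {ffun 'I_k -> N i0} := [ffun j => dsum_at x i0 (cast_ord ek j)].
pose f (x : V) := tile_map h (p x).
have f_lin : linear f.
  move=> a x y; rewrite /f -tile_mapP; congr (tile_map h _).
  by apply/ffunP => j; rewrite !ffunE dsum_atP !ffunE.
pose fL : {linear V -> M} := HB.pack f (GRing.isLinear.Build _ _ _ _ f f_lin).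
exists fL; split.
  move=> x y /inj_h pxy; apply: dsumP => i; apply/ffunP => j.
  have [ii0|ii0] := eqVneq i i0.
    move: j; rewrite ii0 => j.
    by have /ffunP/(_ (cast_ord (esym ek) j)) := pxy; rewrite !ffunE cast_ordKV.
  by case: j => j ltj; exfalso; move: ltj; rewrite /alpha (negbTE ii0) muln0.
apply/seteqP; split=> _ [x _ <-]; first by exists (p x).
pose x0 : {ffun 'I_(alpha i0) -> N i0} := [ffun j => x (cast_ord (esym ek) j)].
exists (dsum_of (@dfwith _ (fun i => {ffun 'I_(alpha i) -> N i}) (fun=> 0) i0 x0)) => //.
rewrite /= /f; congr (tile_map h _); apply/ffunP => j.
by rewrite !ffunE dsum_ofE dfwithin ffunE cast_ordK.
Qed.

(** The identity is a single tile without loss; it serves the finitely many initial modules and the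
    case of finite [D]. *)
Lemma self_tile (M : lmodType R) (eps : Rr) : 0 < eps ->
  exists k (h : 'I_k -> {linear M -> M}), injective (tile_map h) /\
    (1 - eps) * (kdim [set: M])%:R <= (kdim (range (tile_map h)))%:R.
Proof.
move=> eps0; exists 1%N, (fun=> idfun); split.
  move=> u v; rewrite /tile_map !big_ord1 /= => uv.
  by apply/ffunP=> i; rewrite ord1.
rewrite (_ : range _ = setT); first by rewrite ler_piMl // gerBl ltW.
apply/seteqP; split=> // x _; exists [ffun=> x] => //.
by rewrite /tile_map big_ord1 ffunE.
Qed.

(** One tile [U] serves all n >= n0; the list is completed by the n0 modules before, each its own
    tile, with [U] in the last place. *)
Lemma hyperfinite_tiles (M : nat -> lmodType R) : (forall n, fingen (M n)) ->
  (forall eps : Rr, 0 < eps -> exists2 U : lmodType R, fingen U &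
    \forall n \near \oo, exists k (h : 'I_k -> {linear U -> M n}),
      injective (tile_map h) /\
      (1 - eps) * (kdim [set: M n])%:R <= (kdim (range (tile_map h)))%:R) ->
  hyperfinite Rr M.
Proof.
move=> fgM tiles eps eps0; have [U fgU [n0 _ Un0]] := tiles eps eps0.
exists n0.+1, (fun i : 'I_n0.+1 => if (i < n0)%N then M i else U); split.
  by move=> i; case: ifP.
move=> n; suff [k [U' [h [inj_h dim_h [i0 e]]]]] : exists k (U' : lmodType R)
    (h : 'I_k -> {linear U' -> M n}), [/\ injective (tile_map h),
    (1 - eps) * (kdim [set: M n])%:R <= (kdim (range (tile_map h)))%:R
    & exists i0 : 'I_n0.+1, (if (i0 < n0)%N then M i0 else U) = U'].
  have [alpha [f [inj_f rf]]] := dsum_tile_map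
    (N := fun i : 'I_n0.+1 => if (i < n0)%N then M i else U) e inj_h.
  exists (fun x => x \in range (tile_map h)), alpha.
  have -> : [set` (fun x => x \in range (tile_map h))] = range (tile_map h).
    exact: set_mem_set.
  split=> //; last by exists f.
  split; first by apply/mem_set; exists 0 => //; rewrite /tile_map big1 // => i _;
    rewrite ffunE raddf0.
  move=> a x y /set_mem[u _ <-] /set_mem[v _ <-]; apply/mem_set.
  by exists (a *: u + v) => //; rewrite tile_mapP.
have [nn0|n0n] := ltnP n n0.
  have [k [h [inj_h dim_h]]] := self_tile (M n) eps0; exists k, (M n), h; split=> //.
  by exists (Ordinal (leqW nn0)); rewrite /= nn0.
have [k [h [inj_h dim_h]]] := Un0 n n0n; exists k, U, h; split=> //.
by exists ord_max; rewrite /= ltnn.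
Qed.

End HyperfiniteCriterion.

Lemma finite_fingen (R : nzRingType) (M : lmodType R) :
  finite_set [set: M] -> fingen M.
Proof.
by move=> fM; exists setT; split=> //; apply/seteqP; split=> // x _; exact: sub_lspan.
Qed.

Lemma lspan_mod_valP (R : nzRingType) (E : lmodType R) (B : set E) a
  (u v : lspan_mod B) : val (a *: u + v) = a *: val u + val v.
Proof. by rewrite linearP. Qed.

(** * Right translations between generated modules *)

Section Translate.
Variables (K : finFieldType) (R : falgType K) (D : unitAlgType K) (l : nat).
Variable rho : {rmorphism R -> 'M[D]_l}.
Variables V W : set D.

Lemma translate_exists z : is_subspace W -> (forall v, V v -> W (v * z)) ->
  exists h : {linear genmod rho V -> genmod rho W},
    forall u, val (h u) = val u *m (z%:M : 'M[D]_1) :> 'cV[D]_l.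
Proof.
move=> sW VzW.
(* The columns that right multiplication by z sends into the module of [W] form a submodule; it
   contains V^l, hence all that V^l generates. *)
pose C := [set v : repmod rho |
  lspan (col_in W l : set (repmod rho)) ((v : 'cV[D]_l) *m (z%:M : 'M[D]_1))].
have sC : is_subspace C.
  have [s0 sD] := lspan_subspace (col_in W l : set (repmod rho)).
  split=> [|a v v' Cv Cv']; first by rewrite /C /= mul0mx.
  by rewrite /C /= mulmxDl -mulmxA; exact: sD.
have VC : lspan (col_in V l : set (repmod rho)) `<=` C.
  apply: lspan_min => // v Vv; apply: sub_lspan => i.
  by rewrite mxE big_ord1 !mxE eqxx mulr1n; exact: VzW.
have /boolp.choice[h hE] (u : genmod rho V) : exists y : genmod rho W,
    val y = val u *m (z%:M : 'M[D]_1) :> 'cV[D]_l.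
  by apply: lspan_insub; apply: VC; exact: lspan_valP.
have h_lin : linear h.
  move=> a u v; apply: val_inj; rewrite hE !lspan_mod_valP !hE.
  by rewrite !repmodZE mulmxDl mulmxA.
pose hL : {linear genmod rho V -> genmod rho W} :=
  HB.pack h (GRing.isLinear.Build _ _ _ _ h h_lin).
by exists hL => u; exact: hE.
Qed.

End Translate.

(** * Hyperfiniteness of the generated modules *)

Section Hyperfinite.
Variables (Rr : realType) (K : finFieldType) (R : falgType K) (D : unitAlgType K).
Variables (l : nat) (rho : {rmorphism R -> 'M[D]_l}).
Hypothesis rhoZ : forall (a : K) (x : R), rho (a *: x) = map_mx ( *:%R a) (rho x).
Hypothesis skewD : skew_field D.
Local Notation M W := (genmod rho W).

(** Coordinates of elements of [M U] lie in [ext U (struct_coefs rho)], so independence over this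
    larger space, used coordinate by coordinate, makes the sum of the translations injective. *)
Lemma genmod_tiling (U W : set D) k (d : 'I_k -> D) :
  fsub U -> fsub W -> (forall i u, U u -> W (u * d i)) ->
  independent_translates (ext U (struct_coefs rho)) d ->
  exists h : 'I_k -> {linear M U -> M W}, injective (tile_map h) /\
    (k * kdim [set: M U] <= kdim (range (tile_map h)))%N.
Proof.
move=> fU fW UdW indd.
have /boolp.choice[h hE] i := translate_exists rho fW.2 (UdW i).
have tileE u : val (tile_map h u) =
    \sum_i val (u i) *m ((d i)%:M : 'M[D]_1) :> 'cV[D]_l.
  by rewrite /tile_map raddf_sum; apply: eq_bigr => i _; exact: hE.
have inj_h : injective (tile_map h).
  move=> u v /(congr1 val); rewrite !tileE => uv.
  apply/ffunP => i; apply: val_inj; apply/colP => a.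
  apply/eqP; rewrite -subr_eq0; apply/eqP; move: i.
  have sE := (ext_fsub (struct_coefs rho) fU).2.
  apply: (indd (fun i => (val (u i) : 'cV[D]_l) a 0 - (val (v i) : 'cV[D]_l) a 0)).
    by move=> i; apply: subspaceB => //; apply: (lspan_sub_ext rhoZ fU);
      exact: lspan_valP.
  have col_sum (x : {ffun 'I_k -> M U}) :
      \sum_i (val (x i) : 'cV[D]_l) a 0 * d i
      = (\sum_i val (x i) *m ((d i)%:M : 'M[D]_1) : 'cV[D]_l) a 0.
    rewrite summxE; apply: eq_bigr => i _.
    by rewrite mxE big_ord1 !mxE eqxx mulr1n.
  by under eq_bigr do rewrite mulrBl; rewrite sumrB !col_sum uv subrr.
exists h; split=> //.
have fr : fsub (range (tile_map h) : set (restr (M W))).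
  split; first exact: sub_finite_set (genmod_finite rhoZ fW).
  split; first by exists 0 => //; rewrite /tile_map big1 // => i _; rewrite ffunE raddf0.
  move=> a _ _ [u _ <-] [v _ <-]; exists ((a%:A : R) *: u + v) => //.
  by rewrite tile_mapP.
apply: (qcard_le (f := tile_map h) (qcard_ffun_in k (genmod_qcard rhoZ fU))
  (fsub_qcard fr)); first by move=> u _; exists u.
by move=> u v _ _; exact: inj_h.
Qed.

Variable W : nat -> set D.
Hypothesis folW : folner Rr W.

Lemma genmod_hyperfinite : infinite_set [set: D] -> (0 < l)%N ->
  hyperfinite Rr (fun n => M (W n)).
Proof.
move=> infD l0; have fW n : fsub (W n) by case: (folW.1 n).
have fgM n : fingen (M (W n)) by apply/finite_fingen/genmod_finite.
apply: hyperfinite_tiles => // eps eps0.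
pose S := struct_coefs rho.
(* Four losses must fit into eps: a factor 1 + de for V' against V, another for dim M_n against l
   dim W_n, and de dim W_n each for the interior of W_n and for the extra translate in the tiling
   bound. *)
pose de := Num.min eps 1 / 8 : Rr.
have de0 : 0 < de by rewrite divr_gt0 // lt_min eps0 /=.
have de_eps : eps <= 1 -> (1 - eps) * (1 + de) ^+ 2 <= 1 - 2 * de.
  move=> eps1; rewrite (_ : eps = 8 * de); last by rewrite /de min_l //; lra.
  have : 8 * de <= 1 by rewrite /de min_l //; lra.
  by nra.
have ext_le s : \forall n \near \oo,
    (ldim (ext (W n) s))%:R <= (1 + de) * (ldim (W n))%:R :> Rr.
  have : \forall n \near \oo, (ldim (ext (W n) s))%:R / (ldim (W n))%:R <= 1 + de.
    by apply: (cvgr_le (1 : Rr)); [exact: folner_ext|rewrite ltrDl].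
  by apply: filterS => n; rewrite ler_pdivrMr // ltr0n (folner_ldim_gt0 folW).
have inner_ge s : \forall n \near \oo,
    (1 - de) * (ldim (W n))%:R <= (ldim (inner (W n) s))%:R :> Rr.
  have : \forall n \near \oo, 1 - de <= (ldim (inner (W n) s))%:R / (ldim (W n))%:R.
    by apply: (cvgr_ge (1 : Rr)); [exact: folner_inner|rewrite gtrBl].
  by apply: filterS => n; rewrite ler_pdivlMr // ltr0n (folner_ldim_gt0 folW).
have [n1 _ /(_ n1 (leqnn n1)) V_ext] := ext_le S.
set V := W n1 in V_ext; pose V' := ext V S.
have fV' : fsub V' by exact: ext_fsub (fW n1).
(* [s] lists all of V', so [inner (W n) s] consists of the z in W_n with V' z inside W_n. *)
have [s Vs] := (finite_seqP V').1 fV'.1.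
exists (M V); first exact: fgM.
(* Once dim W_n >= c, the single extra V' in (k + 1) dim V' is at most de dim W_n. *)
have [c Vc] : exists c : nat, (ldim V')%:R <= de * c%:R :> Rr.
  exists (Num.truncn ((ldim V')%:R / de)).+1; rewrite mulrC -ler_pdivrMr //.
  by apply/ltW/truncnS_gt.
move: (ext_le S) (inner_ge s) (folner_infinite folW skewD c infD).
apply: filterS3 => n W_ext W_inner cW.
have [_ [v0 Vv0 v00]] := folW.1 n1.
have Uv : exists2 u, V' u & u != 0 by exists v0 => //; exact: (sub_ext _ (fW n1)).
have Z_W u z : V' u -> inner (W n) s z -> W n (u * z).
  by move=> V'u [_]; apply; move: V'u; rewrite Vs.
have [k [d [Zd indd dimZ]]] := tiling skewD fV' (fW n) (inner_fsub s (fW n)) Uv Z_W.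
have [i u Vu|h [inj_h dim_h]] := genmod_tiling (fW n1) (fW n) _ indd.
  by apply: Z_W => //; exact: (sub_ext _ (fW n1)).
exists k, h; split=> //.
(* For eps > 1 the left side is at most 0. *)
have [eps1|/ltW eps1] := leP eps 1; last first.
  by apply: (le_trans (mulr_le0_ge0 _ _)) => //; rewrite subr_le0.
have dimM := kdim_genmod_le rhoZ (fW n).
have dimU := kdim_genmod_ge rhoZ (fW n1).
have {}dimZ : (ldim (inner (W n) s))%:R <= (k%:R + 1) * (ldim V')%:R :> Rr.
  by rewrite -[1](mulr1n 1) -natrD -natrM ler_nat addn1.
have cover : (1 - 2 * de) * (ldim (W n))%:R <= k%:R * (ldim V')%:R :> Rr.
  have : de * c%:R <= de * (ldim (W n))%:R by rewrite ler_pM2l // ler_nat.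
  by move: dimZ W_inner Vc; rewrite mulrDl mul1r; lra.
(* Passing from V' to V costs the factor 1 + de, by which both sides are multiplied first. *)
have kV : (1 - eps) * ((1 + de) * (ldim (W n))%:R) <= k%:R * (ldim V)%:R :> Rr.
  rewrite -(ler_pM2l (_ : 0 < 1 + de)); last by rewrite addr_gt0.
  rewrite [X in X <= _](_ : _ = (1 - eps) * (1 + de) ^+ 2 * (ldim (W n))%:R);
    last by ring.
  apply: (@le_trans _ _ (k%:R * (ldim V')%:R)).
    by apply: le_trans cover; rewrite ler_wpM2r // de_eps.
  by rewrite mulrCA ler_wpM2l.
apply: (@le_trans _ _ (l%:R * (k%:R * (ldim V)%:R))); last first.
  rewrite -!natrM ler_nat; apply: leq_trans dim_h.
  by rewrite mulnCA leq_mul2l dimU orbT.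
apply: (@le_trans _ _ ((1 - eps) * (l%:R * ((1 + de) * (ldim (W n))%:R)))).
  rewrite ler_wpM2l ?subr_ge0 //; apply: le_trans (_ : (l * ldim (ext (W n) S))%:R <= _).
    by rewrite ler_nat.
  by rewrite natrM ler_wpM2l.
by rewrite mulrCA ler_wpM2l.
Qed.

End Hyperfinite.

(** * Choice of the Foelner sequence according to whether [D] is finite *)

Theorem theorem5 (Rr : realType) (K : finFieldType) (R : falgType K)
  (D : unitAlgType K) (l : nat) (rho : {rmorphism R -> 'M[D]_l}) :
  (0 < l)%N ->
  skew_field D ->
  amenable_algebra Rr D ->
  (forall (a : K) (x : R), rho (a *: x) = map_mx ( *:%R a) (rho x)) ->
  amenable_rank (fun k m : nat => @rk_rep Rr K R D l rho k m).
Proof.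
move=> l0 skewD [_ [W [W_fin W_cvg]]] rhoZ.
suff [W' [folW hypW]] : exists W' : nat -> set D,
    folner Rr W' /\ hyperfinite Rr (fun n => genmod rho (W' n)).
  have fW n : fsub (W' n) by case: (folW.1 n).
  exists (fun n => genmod rho (W' n)); split=> // [n|k m A].
    split; first exact/finite_fingen/genmod_finite.
    have [_ [w Ww w0]] := folW.1 n.
    (* The constant column w gives a nonzero element of the module, as l > 0. *)
    have [|y yw] := @genmod_insub K R D l rho (W' n) (const_mx w).
      by move=> i; rewrite mxE.
    exists y; apply: contra_neq w0 => y0; move: yw; rewrite y0 raddf0.
    by move/colP/(_ (Ordinal l0)); rewrite !mxE.
  exact: rk_mod_cvg.
have folW : folner Rr W.
  split=> [n|a]; last exact: W_cvg.
  by have [fWn W0] := W_fin n; split=> //; exact: finite_ldim_fsub.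
(* For finite [D] the dimensions of W_n are bounded, and the extra translate need not become
   negligible. The constant sequence [D] is then exactly invariant, and its one module tiles
   itself. *)
have [finD|infD] := pselect (finite_set [set: D]); last first.
  by exists W; split=> //; exact: genmod_hyperfinite.
have fT : fsub [set: D] by [].
exists (fun=> setT); split.
  split=> [_|a]; first by split=> //; exists 1; rewrite ?oner_neq0.
  have -> : ext [set: D] [:: a] = setT.
    by apply/seteqP; split=> // x _; exact: sub_ext.
  under eq_cvg do rewrite divff ?pnatr_eq0 -?lt0n ?(ldim_gt0 fT (_ : setT 1)) ?oner_neq0 //.
  exact: cvg_cst.
have fgM : fingen (genmod rho setT) by exact/finite_fingen/genmod_finite.
apply: hyperfinite_tiles => // eps eps0; exists (genmod rho setT) => //.
by apply: nearW => n; exact: self_tile.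
Qed.
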